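(* Let $\Delta x,\Delta t>0$ and let $(\widetilde w_i^n)_{i\in\mathbb Z}\subset\widetilde\Omega$, $\widetilde w_i^n=(w_i^n,z_i)$. Define the reconstructed states $\widetilde w_i^{n,\pm}=\widetilde w_i^n\pm\theta_i^n\frac{\Delta x}2\sigma_i^n(\widetilde w)$, with $\theta_i^n$ and $\sigma_i^n(\widetilde w)$ as in the context, and the scheme $$w_i^{n+1}=w_i^n-\frac{\Delta t}{\Delta x}\Big(F(\widetilde w_i^{n,+},\widetilde w_{i+1}^{n,-},\Delta x_1)-F(\widetilde w_{i-1}^{n,+},\widetilde w_i^{n,-},\Delta x_1)\Big)+\frac{\Delta t}{2\Delta x}\Big(S(\widetilde w_{i-1}^{n,+},\widetilde w_i^{n,-},\Delta x_1)+2S(\widetilde w_i^{n,-},\widetilde w_i^{n,+},\Delta x_2)+S(\widetilde w_i^{n,+},\widetilde w_{i+1}^{n,-},\Delta x_1)\Big),$$ where, in the update of cell $i$, $\Delta x_1=\Delta x\big(1-\frac{\theta_i^n}2\big)$ and $\Delta x_2=\theta_i^n\frac{\Delta x}2$, and $F(\cdot,\cdot,d)$, $S(\cdot,\cdot,d)$ are the numerical flux and source term of the context. Assume the CFL condition $$\frac{\Delta t}{\Delta x}\max_{i\in\mathbb Z}\Big(|\lambda^\pm(\widetilde w_i^{n,-},\widetilde w_i^{n,+})|,\ |\lambda^\pm(\widetilde w_i^{n,+},\widetilde w_{i+1}^{n,-})|\Big)\le\frac14,$$ where $\lambda^-=\lambda_L$ and $\lambda^+=\lambda_R$ are the wave speeds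 of the approximate Riemann solver, and assume that these speeds satisfy $\lambda_L<u_L$ and $\lambda_R>u_R$ for every pair of data. Then the scheme is fully well-balanced, i.e. if $(\widetilde w_i^n)_{i\in\mathbb Z}$ is a discrete steady state then $w_i^{n+1}=w_i^n$ for all $i\in\mathbb Z$; and it preserves the positivity of $h$, i.e. if $h_i^n>0$ for all $i\in\mathbb Z$ then $h_i^{n+1}>0$ for all $i\in\mathbb Z$.
   Context: Constants: $g>0$ (gravity), $f\in\mathbb R$ (Coriolis parameter), $\varepsilon>0$ (small threshold). The system is the 1D rotating shallow water system $\partial_t h+\partial_x(hu)=0$, $\partial_t(hu)+\partial_x(hu^2+gh^2/2)=fhv-gh\,\partial_xz$, $\partial_t(hv)+\partial_x(huv)=-fhu$. States are $w=(h,hu,hv)^T\in\Omega=\{w\in\mathbb R^3:h>0\}$, with flux $\Phi(w)=(hu,\,hu^2+gh^2/2,\,huv)^T$; $\widetilde w=(w,z)\in\widetilde\Omega=\{(h,hu,hv,z)^T\in\mathbb R^4:h>0\}$, where $z$ is the (time-independent) topography value. Notation: for a quantity $X$ with left and right values, $[X]=X_R-X_L$ and $\overline X=(X_L+X_R)/2$. Steady states: for $(\widetilde w_L,\widetilde w_R)\in\widetilde\Omega^2$ and $d\ge0$ let $$\mathcal E(\widetilde w_L,\widetilde w_R,d)=\sqrt{\big|[hu]\big|^2+\Big|\big[\tfrac{u^2}2+g(h+z)\big]-d\,f\,\overline v\Big|^2+\big|\overline{hu}\,([v]+f d)\big|^2}.$$ A pair is a local steady state (with spacing $d$) if $\mathcal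 E(\widetilde w_L,\widetilde w_R,d)=0$. A sequence $(\widetilde w_i)_{i\in\mathbb Z}$ is a discrete steady state if $\mathcal E(\widetilde w_i,\widetilde w_{i+1},\Delta x)=0$ for every $i$. Detector: $\theta(x)=\frac{x^2}{x^2+\Delta x^2}$, $\theta_i^n=\theta(\mathcal E_i^n)$, $\mathcal E_i^n=\mathcal E(\widetilde w_{i-1}^n,\widetilde w_i^n,\Delta x)+\mathcal E(\widetilde w_i^n,\widetilde w_{i+1}^n,\Delta x)$. Slopes: $\sigma_i^n(\widetilde w)=\mathrm{minmod}\big(\frac{\widetilde w_i^n-\widetilde w_{i-1}^n}{\Delta x},\frac{\widetilde w_{i+1}^n-\widetilde w_i^n}{\Delta x}\big)\in\mathbb R^4$ componentwise, where $\mathrm{minmod}(a,b)=\min(a,b)$ if $a,b>0$, $\max(a,b)$ if $a,b<0$, and $0$ otherwise; the first component (slope of $h$) is additionally limited, if necessary, so that the reconstructed heights $h_i^{n}\pm\frac{\Delta x}{2}\sigma_i^n(h)$ are positive (whenever the $h_i^n$ are positive). Numerical source term with parameter $d\ge0$: write $\mathcal E_{LR}=\mathcal E(\widetilde w_L,\widetilde w_R,d)$, $\mathrm{Fr}=\frac{\overline h\,|u_Lu_R|}{g\,h_Lh_R}$, and let $\widetilde q$ be a fixed real-valued function of the data that equals the common discharge $q=h_Lu_L=h_Ru_R$ whenever $(\widetilde w_L,\widetilde w_R)$ is a local steady state with spacing $d$ and equals $hu$ whenever $w_L=w_R=w$ (for instance $\widetilde q=\overline{hu}$). Then $S(\widetilde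 w_L,\widetilde w_R,d)=(0,S^{hu},S^{hv})^T$ with $$S^{hu}=\begin{cases}d f\,\overline h\,\overline v-g\overline h[z]+\dfrac{g\,\mathrm{Fr}\,[h]}{4\overline h}\,\dfrac{(d f\overline v/g-[z])^2}{(1-\mathrm{Fr})^2+\mathcal E_{LR}}&\text{if }\mathrm{Fr}\ne1\text{ or }\mathcal E_{LR}\neq0,\\[1em]\dfrac{g}{4\overline h}[h]^3&\text{if }\mathrm{Fr}=1\text{ and }\mathcal E_{LR}=0,\end{cases}\qquad S^{hv}=-d f\,\widetilde q .$$ Approximate Riemann solver and flux with parameter $d>0$: wave speeds are functions $\lambda_L(\widetilde w_L,\widetilde w_R)<0<\lambda_R(\widetilde w_L,\widetilde w_R)$. The solver takes the value $w_L$ for $x/t<\lambda_L$, $w_L^\star(d)$ for $\lambda_L<x/t<0$, $w_R^\star(d)$ for $0<x/t<\lambda_R$, $w_R$ for $x/t>\lambda_R$, where $w^\star_{L}=(h_L^\star,h_L^\star u_L^\star,h_L^\star v_L^\star)^T$ and $w^\star_{R}=(h_R^\star,h_R^\star u_R^\star,h_R^\star v_R^\star)^T$ are defined as follows. Let $$w^{HLL}=(h^{HLL},(hu)^{HLL},(hv)^{HLL})^T=\frac{\lambda_Rw_R-\lambda_Lw_L}{\lambda_R-\lambda_L}-\frac{\Phi(w_R)-\Phi(w_L)}{\lambda_R-\lambda_L},\quad \alpha_{LR}=g\overline h-|u_Lu_R|,\quad \delta=\min(\varepsilon,h_L,h_R,h^{HLL}),$$ $$\Delta^h_{LR}=\begin{cases}\dfrac{\alpha_{LR}S^{hu}}{\alpha_{LR}^2+\mathcal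 E_{LR}}&\mathcal E_{LR}\ne0\\ h_R-h_L&\mathcal E_{LR}=0\end{cases},\qquad \Delta^v_{LR}=\begin{cases}\dfrac{\widetilde q\,S^{hv}}{\widetilde q^2+\mathcal E_{LR}}&\mathcal E_{LR}\ne0\\ v_R-v_L&\mathcal E_{LR}=0\end{cases}.$$ Then $$h_L^\star u_L^\star=h_R^\star u_R^\star=(hu)^{HLL}+\frac{S^{hu}}{\lambda_R-\lambda_L},$$ $$h_L^\star=\min\Big(\max\big(h^{HLL}-\tfrac{\lambda_R}{\lambda_R-\lambda_L}\Delta^h_{LR},\delta\big),\big(1-\tfrac{\lambda_R}{\lambda_L}\big)h^{HLL}+\tfrac{\lambda_R}{\lambda_L}\delta\Big),$$ $$h_R^\star=\min\Big(\max\big(h^{HLL}-\tfrac{\lambda_L}{\lambda_R-\lambda_L}\Delta^h_{LR},\delta\big),\big(1-\tfrac{\lambda_L}{\lambda_R}\big)h^{HLL}+\tfrac{\lambda_L}{\lambda_R}\delta\Big),$$ $$v_L^\star=\frac{(hv)^{HLL}}{h^{HLL}}+\frac{S^{hv}-\lambda_Rh_R^\star\Delta^v_{LR}}{(\lambda_R-\lambda_L)h^{HLL}},\qquad v_R^\star=\frac{(hv)^{HLL}}{h^{HLL}}+\frac{S^{hv}-\lambda_Lh_L^\star\Delta^v_{LR}}{(\lambda_R-\lambda_L)h^{HLL}}.$$ The numerical flux is $$F(\widetilde w_L,\widetilde w_R,d)=\overline{\Phi(w)}+\frac{\lambda_R}2(w_R^\star-w_R)+\frac{\lambda_L}2(w_L^\star-w_L).$$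 *)

(* Defs.v *)
From HB Require Import structures.
From mathcomp Require Import all_boot all_order all_algebra.
From mathcomp Require Import reals.

Set Implicit Arguments.
Unset Strict Implicit.
Unset Printing Implicit Defensive.

Import Order.TTheory GRing.Theory Num.Theory.
Local Open Scope ring_scope.

Section States.
Variable R : realType.
Implicit Types (w : 'rV[R]_3) (s sL sR : 'rV[R]_(3 + 1)).

Definition row3 (a b c : R) : 'rV[R]_3 := \row_(j < 3) [:: a; b; c]`_j.

Definition avg (a b : R) : R := (a + b) / 2.
Definition jump (a b : R) : R := b - a.

Definition height w : R := w 0 0.
Definition hu w : R := w 0 1.
Definition hv w : R := w 0 2%:R.
Definition uvel w : R := hu w / height w.
Definition vvel w : R := hv w / height w.

(* An augmented state is s = (w, z) in R^(3 + 1); z is its last entry. *)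
Definition wpart s : 'rV[R]_3 := lsubmx s.
Definition topo s : R := s 0 ord_max.

Definition Omega w : Prop := 0 < height w.
Definition Omegat s : Prop := Omega (wpart s).

Definition minmod (a b : R) : R :=
  if (0 < a) && (0 < b) then Num.min a b
  else if (a < 0) && (b < 0) then Num.max a b
  else 0.

End States.

Section Scheme.
Variable R : realType.
Local Notation state := 'rV[R]_3.
Local Notation astate := 'rV[R]_(3 + 1).
Implicit Types (w : state) (s sL sR : astate) (d : R).

(* Gravity, Coriolis parameter, height threshold. *)
Variables (g f eps : R).
Variables (lamL lamR : astate -> astate -> R).
(* qt sL sR d is the discharge denoted q-tilde. *)
Variable qt : astate -> astate -> R -> R.

Definition Phi w : state :=
  row3 (hu w) (height w * uvel w ^+ 2 + g * height w ^+ 2 / 2)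
       (height w * uvel w * vvel w).

Definition hbar sL sR : R := avg (height (wpart sL)) (height (wpart sR)).
Definition vbar sL sR : R := avg (vvel (wpart sL)) (vvel (wpart sR)).
Definition hubar sL sR : R := avg (hu (wpart sL)) (hu (wpart sR)).
Definition hjump sL sR : R := jump (height (wpart sL)) (height (wpart sR)).
Definition vjump sL sR : R := jump (vvel (wpart sL)) (vvel (wpart sR)).
Definition zjump sL sR : R := jump (topo sL) (topo sR).

Definition bernoulli s : R :=
  uvel (wpart s) ^+ 2 / 2 + g * (height (wpart s) + topo s).

Definition steady_error sL sR d : R :=
  Num.sqrt (`|jump (hu (wpart sL)) (hu (wpart sR))| ^+ 2
            + `|jump (bernoulli sL) (bernoulli sR) - d * f * vbar sL sR| ^+ 2
            + `|hubar sL sR * (vjump sL sR + f * d)| ^+ 2).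

Definition local_steady_state sL sR d : Prop := steady_error sL sR d = 0.

Definition discrete_steady_state (dx : R) (s : int -> astate) : Prop :=
  forall i : int, local_steady_state (s i) (s (i + 1)) dx.

Definition admissible_speeds : Prop :=
  forall sL sR, Omegat sL -> Omegat sR ->
    [/\ lamL sL sR < 0, 0 < lamR sL sR,
        lamL sL sR < uvel (wpart sL) & uvel (wpart sR) < lamR sL sR].

Definition admissible_discharge : Prop :=
  forall sL sR d, Omegat sL -> Omegat sR -> 0 <= d ->
    (local_steady_state sL sR d ->
       qt sL sR d = height (wpart sL) * uvel (wpart sL)
       /\ qt sL sR d = height (wpart sR) * uvel (wpart sR))
    /\ (wpart sL = wpart sR -> qt sL sR d = hu (wpart sL)).

Definition Fr sL sR : R :=
  hbar sL sR * `|uvel (wpart sL) * uvel (wpart sR)|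
  / (g * height (wpart sL) * height (wpart sR)).

Definition Shu sL sR d : R :=
  let e := steady_error sL sR d in
  if (Fr sL sR != 1) || (e != 0) then
    d * f * hbar sL sR * vbar sL sR - g * hbar sL sR * zjump sL sR
    + g * Fr sL sR * hjump sL sR / (4 * hbar sL sR)
      * ((d * f * vbar sL sR / g - zjump sL sR) ^+ 2
         / ((1 - Fr sL sR) ^+ 2 + e))
  else g / (4 * hbar sL sR) * hjump sL sR ^+ 3.

Definition Shv sL sR d : R := - (d * f * qt sL sR d).

Definition source sL sR d : state := row3 0 (Shu sL sR d) (Shv sL sR d).

Definition hll sL sR : state :=
  let lL := lamL sL sR in let lR := lamR sL sR in
  (lR - lL)^-1 *: (lR *: wpart sR - lL *: wpart sL)
  - (lR - lL)^-1 *: (Phi (wpart sR) - Phi (wpart sL)).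

Definition alpha sL sR : R :=
  g * hbar sL sR - `|uvel (wpart sL) * uvel (wpart sR)|.

Definition delta sL sR : R :=
  Num.min (Num.min eps (height (wpart sL)))
          (Num.min (height (wpart sR)) (height (hll sL sR))).

Definition Deltah sL sR d : R :=
  let e := steady_error sL sR d in
  if e != 0 then alpha sL sR * Shu sL sR d / (alpha sL sR ^+ 2 + e)
  else height (wpart sR) - height (wpart sL).

Definition Deltav sL sR d : R :=
  let e := steady_error sL sR d in
  if e != 0 then qt sL sR d * Shv sL sR d / (qt sL sR d ^+ 2 + e)
  else vvel (wpart sR) - vvel (wpart sL).

Definition hustar sL sR d : R :=
  hu (hll sL sR) + Shu sL sR d / (lamR sL sR - lamL sL sR).

Definition hLstar sL sR d : R :=
  let lL := lamL sL sR in let lR := lamR sL sR in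
  let hh := height (hll sL sR) in
  Num.min (Num.max (hh - lR / (lR - lL) * Deltah sL sR d) (delta sL sR))
          ((1 - lR / lL) * hh + lR / lL * delta sL sR).

Definition hRstar sL sR d : R :=
  let lL := lamL sL sR in let lR := lamR sL sR in
  let hh := height (hll sL sR) in
  Num.min (Num.max (hh - lL / (lR - lL) * Deltah sL sR d) (delta sL sR))
          ((1 - lL / lR) * hh + lL / lR * delta sL sR).

Definition vLstar sL sR d : R :=
  let lL := lamL sL sR in let lR := lamR sL sR in
  let hh := height (hll sL sR) in
  hv (hll sL sR) / hh
  + (Shv sL sR d - lR * hRstar sL sR d * Deltav sL sR d) / ((lR - lL) * hh).

Definition vRstar sL sR d : R :=
  let lL := lamL sL sR in let lR := lamR sL sR in
  let hh := height (hll sL sR) in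
  hv (hll sL sR) / hh
  + (Shv sL sR d - lL * hLstar sL sR d * Deltav sL sR d) / ((lR - lL) * hh).

Definition wLstar sL sR d : state :=
  row3 (hLstar sL sR d) (hustar sL sR d) (hLstar sL sR d * vLstar sL sR d).

Definition wRstar sL sR d : state :=
  row3 (hRstar sL sR d) (hustar sL sR d) (hRstar sL sR d * vRstar sL sR d).

Definition flux sL sR d : state :=
  2^-1 *: (Phi (wpart sL) + Phi (wpart sR))
  + (lamR sL sR / 2) *: (wRstar sL sR d - wpart sR)
  + (lamL sL sR / 2) *: (wLstar sL sR d - wpart sL).

Variables (dx dt : R).
(* The data of one time level, and the slopes used at that time level. *)
Variables (s sigma : int -> astate).

Definition cell_error (i : int) : R :=
  steady_error (s (i - 1)) (s i) dx + steady_error (s i) (s (i + 1)) dx.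

Definition theta (x : R) : R := x ^+ 2 / (x ^+ 2 + dx ^+ 2).

Definition thetac (i : int) : R := theta (cell_error i).

Definition minmod_slope (i : int) : astate :=
  \row_j minmod ((s i 0 j - s (i - 1) 0 j) / dx)
                ((s (i + 1) 0 j - s i 0 j) / dx).

Definition heights_kept (i : int) (a : R) : Prop :=
  0 < height (wpart (s i)) - dx / 2 * a
  /\ 0 < height (wpart (s i)) + dx / 2 * a.

(* The slopes are the minmod slopes, except that the slope of h (entry 0) may
   be replaced by any other value keeping the reconstructed heights positive,
   in those cells where the minmod slope itself does not keep them positive. *)
Definition limited_minmod_slopes : Prop :=
  forall i : int,
    [/\ forall j : 'I_(3 + 1), j != 0%N :> nat ->
          sigma i 0 j = minmod_slope i 0 j,
        heights_kept i (height (wpart (minmod_slope i))) ->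
          height (wpart (sigma i)) = height (wpart (minmod_slope i))
      & (forall k : int, 0 < height (wpart (s k))) ->
          heights_kept i (height (wpart (sigma i)))].

Definition rec_plus (i : int) : astate :=
  s i + (thetac i * (dx / 2)) *: sigma i.
Definition rec_minus (i : int) : astate :=
  s i - (thetac i * (dx / 2)) *: sigma i.

Definition dx1 (i : int) : R := dx * (1 - thetac i / 2).
Definition dx2 (i : int) : R := thetac i * (dx / 2).

(* Both interface fluxes of cell i use the spacing dx1 i of that cell, so the
   two cells sharing an interface need not use the same flux there. *)
Definition update (i : int) : state :=
  wpart (s i)
  - (dt / dx) *: (flux (rec_plus i) (rec_minus (i + 1)) (dx1 i)
                  - flux (rec_plus (i - 1)) (rec_minus i) (dx1 i))
  + (dt / (2 * dx)) *: (source (rec_plus (i - 1)) (rec_minus i) (dx1 i)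
                        + 2 *: source (rec_minus i) (rec_plus i) (dx2 i)
                        + source (rec_plus i) (rec_minus (i + 1)) (dx1 i)).

Definition speed_bound sL sR : R :=
  Num.max `|lamL sL sR| `|lamR sL sR|.

Definition CFL : Prop :=
  forall i : int,
    dt / dx * Num.max (speed_bound (rec_minus i) (rec_plus i))
                      (speed_bound (rec_plus i) (rec_minus (i + 1))) <= 4^-1.

End Scheme.

(* Main.v *)
(* Well-balancedness: on a steady pair the source equals the jump of the
   physical flux and both intermediate states reduce to the data, so the
   numerical flux is the average of the physical fluxes. Since a discrete steady
   state has vanishing detector, the reconstruction is trivial and flux
   differences cancel the sources.

   Positivity: the intermediate heights are positive and satisfy the HLL
   consistency relation, so the height flux is [hu_L + lamL (hL* - hL)] and also
   [hu_R + lamR (hR* - hR)]. A cell is the mean of two half cells separated by a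
   fictitious interface between the two reconstructed states of the cell. In each
   half cell the discharge cancels, and the CFL condition makes the new height a
   positive combination of the old one and of intermediate heights. *)
Require Import Defs.
From HB Require Import structures.
From mathcomp Require Import all_boot all_order all_algebra.
From mathcomp Require Import reals.
From mathcomp Require Import ring lra.

Set Implicit Arguments.
Unset Strict Implicit.
Unset Printing Implicit Defensive.

Import Order.TTheory GRing.Theory Num.Theory.
Local Open Scope ring_scope.

(** * Coordinatewise calculus on states *)

Section Rows.
Variable R : realType.
Implicit Types (a b c : R) (w : 'rV[R]_3) (s : 'rV[R]_(3 + 1)).

Lemma height_row3 a b c : height (row3 a b c) = a.
Proof. by rewrite /height mxE. Qed.

Lemma hu_row3 a b c : hu (row3 a b c) = b.
Proof. by rewrite /hu mxE. Qed.

Lemma hv_row3 a b c : hv (row3 a b c) = c.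
Proof. by rewrite /hv mxE. Qed.

Lemma heightD w1 w2 : height (w1 + w2) = height w1 + height w2.
Proof. by rewrite /height mxE. Qed.

Lemma heightN w : height (- w) = - height w.
Proof. by rewrite /height mxE. Qed.

Lemma heightZ a w : height (a *: w) = a * height w.
Proof. by rewrite /height mxE. Qed.

Lemma huD w1 w2 : hu (w1 + w2) = hu w1 + hu w2.
Proof. by rewrite /hu mxE. Qed.

Lemma huN w : hu (- w) = - hu w.
Proof. by rewrite /hu mxE. Qed.

Lemma huZ a w : hu (a *: w) = a * hu w.
Proof. by rewrite /hu mxE. Qed.

Lemma hvD w1 w2 : hv (w1 + w2) = hv w1 + hv w2.
Proof. by rewrite /hv mxE. Qed.

Lemma hvN w : hv (- w) = - hv w.
Proof. by rewrite /hv mxE. Qed.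

Lemma hvZ a w : hv (a *: w) = a * hv w.
Proof. by rewrite /hv mxE. Qed.

Definition heightE := (heightD, heightN, heightZ, height_row3).
Definition hvE := (hvD, hvN, hvZ, hv_row3).

Lemma state_eq w1 w2 :
  height w1 = height w2 -> hu w1 = hu w2 -> hv w1 = hv w2 -> w1 = w2.
Proof.
move=> e0 e1 e2; apply/rowP=> j; case: j => [[|[|[|//]]] lt_j].
- by rewrite (_ : Ordinal lt_j = 0) //; apply/val_inj.
- by rewrite (_ : Ordinal lt_j = 1) //; apply/val_inj.
- by rewrite (_ : Ordinal lt_j = 2%:R) //; apply/val_inj.
Qed.

Lemma row3_eta w : row3 (height w) (hu w) (hv w) = w.
Proof. by apply: state_eq; rewrite ?height_row3 ?hu_row3 ?hv_row3. Qed.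

Lemma wpartD s1 s2 : wpart (s1 + s2) = wpart s1 + wpart s2.
Proof. exact: linearD. Qed.

Lemma wpartN s : wpart (- s) = - wpart s.
Proof. exact: linearN. Qed.

Lemma wpartZ a s : wpart (a *: s) = a *: wpart s.
Proof. exact: linearZ. Qed.

End Rows.

(** * Real algebra of the cut-offs and of steady pairs *)

Lemma clamp_ge (R : realType) (l r hh dlt : R) :
  l < 0 -> 0 < r -> dlt <= hh ->
  dlt <= (1 - r / l) * hh + r / l * dlt /\ dlt <= (1 - l / r) * hh + l / r * dlt.
Proof.
move=> l0 r0 dlt_le.
(* As [l] and [r] have opposite signs, each upper bound is [hh] plus a nonnegative multiple of
   [hh - dlt]. *)
have -> : (1 - r / l) * hh + r / l * dlt = hh + (r / - l) * (hh - dlt).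
  by field; lra.
have -> : (1 - l / r) * hh + l / r * dlt = hh + (- l / r) * (hh - dlt).
  by field; lra.
have : 0 <= (r / - l) * (hh - dlt).
  by apply: mulr_ge0; [apply: divr_ge0|]; lra.
have : 0 <= (- l / r) * (hh - dlt).
  by apply: mulr_ge0; [apply: divr_ge0|]; lra.
by lra.
Qed.

(* The two cut-offs are dual: one side is raised to [dlt] exactly when the
   other side is lowered to its upper bound. *)
Lemma clamp_consistent (R : realType) (l r hh D dlt : R) :
  l < 0 -> 0 < r -> dlt <= hh ->
  r * Num.min (Num.max (hh - l / (r - l) * D) dlt)
              ((1 - l / r) * hh + l / r * dlt)
  - l * Num.min (Num.max (hh - r / (r - l) * D) dlt)
                ((1 - r / l) * hh + r / l * dlt)
    = (r - l) * hh.
Proof.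
move=> l0 r0 dlt_le; have [] := clamp_ge l0 r0 dlt_le.
(* Consistency holds for three pairs: both values unclamped, or one side at [dlt] and the other at
   its upper bound. Subtracting two of these relations links the cut-offs of the two sides, since
   [l < 0 < r]. *)
have : r * (hh - l / (r - l) * D) - l * (hh - r / (r - l) * D) = (r - l) * hh.
  by field; lra.
have : r * ((1 - l / r) * hh + l / r * dlt) - l * dlt = (r - l) * hh.
  by field; lra.
have : r * dlt - l * ((1 - r / l) * hh + r / l * dlt) = (r - l) * hh.
  by field; lra.
move: (hh - l / _ * D) (hh - r / _ * D) => b a.
move: (_ + r / l * dlt) (_ + l / r * dlt) => mL mR mLE mRE abE dltL dltR.
have aP : (a <= dlt) = (mR <= b).
  by rewrite -(ler_nM2l l0 dlt a) -(ler_pM2l r0 mR b); apply/idP/idP; lra.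
have bP : (b <= dlt) = (mL <= a).
  by rewrite -(ler_pM2l r0 b dlt) -(ler_nM2l l0 a mL); apply/idP/idP; lra.
have [ale|alt] := lerP a dlt.
  by rewrite (min_l dltL) min_r ?mRE // le_max -aP ale.
have [ble|blt] := lerP b dlt.
  by rewrite (min_l dltR) min_r ?mLE // -bP.
by rewrite !min_l // ltW // ltNge -?aP -?bP -ltNge.
Qed.

(** A vanishing sum of squares kills each term. The relation on [v] keeps its discharge factor: at
    zero discharge the jump of [v] is free. *)
Lemma local_steady_stateP (R : realType) (g f : R) (sL sR : 'rV[R]_(3 + 1)) (d : R) :
  local_steady_state g f sL sR d ->
  [/\ hu (wpart sR) = hu (wpart sL),
      bernoulli g sR - bernoulli g sL = d * f * vbar sL sR
    & hu (wpart sL) * (vvel (wpart sR) - vvel (wpart sL)) = - (d * f * hu (wpart sL))].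
Proof.
move/eqP; rewrite sqrtr_eq0.
set A := `|_| ^+ 2; set B := `|_| ^+ 2; set C := `|_| ^+ 2 => le0.
have [A0 B0 C0] : [/\ 0 <= A, 0 <= B & 0 <= C] by rewrite !sqr_ge0.
have /eqP : A = 0 by lra.
have /eqP : B = 0 by lra.
have /eqP : C = 0 by lra.
rewrite !sqrf_eq0 !normr_eq0 subr_eq0 /hubar /avg /vjump /jump.
move=> /eqP eC /eqP eB; rewrite subr_eq0 => /eqP eA.
by split=> //; move: eC; rewrite eA; lra.
Qed.

(* [X] stands for [d f vbar / g - [z]]; the Bernoulli relation says
   [X = (1 - Fr) [h]], which makes the source exact. *)
Lemma steady_momentum (R : realType) (g hL hR q X : R) :
  0 < g -> 0 < hL -> 0 < hR ->
  ((q / hR) ^+ 2 / 2 + g * hR) - ((q / hL) ^+ 2 / 2 + g * hL) = g * X ->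
  let F := avg hL hR * (q / hL * (q / hR)) / (g * hL * hR) in
  X = (1 - F) * (hR - hL)
  /\ g * avg hL hR * X + g * F / (4 * avg hL hR) * (hR - hL) ^+ 3
     = (hR * (q / hR) ^+ 2 + g * hR ^+ 2 / 2) - (hL * (q / hL) ^+ 2 + g * hL ^+ 2 / 2).
Proof.
move=> g0 hL0 hR0 eX F.
have XE : X = (1 - F) * (hR - hL).
  have g_neq0 : g != 0 by rewrite gt_eqF.
  by apply: (mulfI g_neq0); rewrite -eX /F /avg; field; lra.
by split=> //; rewrite XE /F /avg; field; lra.
Qed.

(** * Intermediate heights and height flux of the Riemann solver *)

Section Solver.
Variables (R : realType) (g f eps : R).
Local Notation astate := 'rV[R]_(3 + 1).
Variables (lamL lamR : astate -> astate -> R) (qt : astate -> astate -> R -> R).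
Hypotheses (g_gt0 : 0 < g) (eps_gt0 : 0 < eps).
Hypotheses (speedsP : admissible_speeds lamL lamR).
Hypothesis (qtP : admissible_discharge g f qt).

Section Pair.
Variables (sL sR : astate) (d : R).
Hypotheses (OL : Omegat sL) (OR : Omegat sR).

Local Notation hL := (height (wpart sL)).
Local Notation hR := (height (wpart sR)).
Local Notation lL := (lamL sL sR).
Local Notation lR := (lamR sL sR).
Local Notation hh := (height (hll g lamL lamR sL sR)).

Lemma hll_heightE :
  (lR - lL) * hh = lR * hR - lL * hL - (hu (wpart sR) - hu (wpart sL)).
Proof.
have [lL0 lR0 _ _] := speedsP OL OR.
by rewrite /hll !heightE; field; lra.
Qed.

(** With [uL], [uR] the velocities, [(lR - lL) * hh] is [hR * (lR - uR) + hL * (uL - lL)], positive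
    since [lL < uL] and [uR < lR]. *)
Lemma hll_height_gt0 : 0 < hh.
Proof.
have [lL0 lR0 luL luR] := speedsP OL OR.
have D0 : 0 < lR - lL by lra.
rewrite -(pmulr_rgt0 _ D0) hll_heightE.
have hL0 : 0 < hL := OL.
have hR0 : 0 < hR := OR.
have huLE : hu (wpart sL) = hL * uvel (wpart sL) by rewrite /uvel; field; lra.
have huRE : hu (wpart sR) = hR * uvel (wpart sR) by rewrite /uvel; field; lra.
have : 0 < hR * (lR - uvel (wpart sR)) by apply: mulr_gt0 => //; lra.
have : 0 < hL * (uvel (wpart sL) - lL) by apply: mulr_gt0 => //; lra.
by rewrite huLE huRE; lra.
Qed.

Lemma delta_gt0 : 0 < delta g eps lamL lamR sL sR.
Proof. by rewrite /delta !lt_min eps_gt0 OL OR hll_height_gt0. Qed.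

Lemma delta_le :
  [/\ delta g eps lamL lamR sL sR <= hL, delta g eps lamL lamR sL sR <= hR
    & delta g eps lamL lamR sL sR <= hh].
Proof. by rewrite /delta; split; rewrite !ge_min lexx ?orbT. Qed.

Lemma star_height_gt0 :
  0 < hLstar g f eps lamL lamR sL sR d /\ 0 < hRstar g f eps lamL lamR sL sR d.
Proof.
have [lL0 lR0 _ _] := speedsP OL OR.
have [_ _ dlt_le] := delta_le.
have [dltL dltR] := clamp_ge lL0 lR0 dlt_le.
by rewrite /hLstar /hRstar !lt_min !lt_max delta_gt0 !orbT /=;
  split; apply: lt_le_trans delta_gt0 _.
Qed.

Lemma star_height_consistent :
  lR * hRstar g f eps lamL lamR sL sR d - lL * hLstar g f eps lamL lamR sL sR d
    = lR * hR - lL * hL - (hu (wpart sR) - hu (wpart sL)).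
Proof.
have [lL0 lR0 _ _] := speedsP OL OR.
have [_ _ dlt_le] := delta_le.
by rewrite -hll_heightE /hLstar /hRstar clamp_consistent.
Qed.

Lemma height_fluxL :
  height (flux g f eps lamL lamR qt sL sR d)
    = hu (wpart sL) + lL * (hLstar g f eps lamL lamR sL sR d - hL).
Proof.
by have := star_height_consistent; rewrite /flux !heightE; lra.
Qed.

Lemma height_fluxR :
  height (flux g f eps lamL lamR qt sL sR d)
    = hu (wpart sR) + lR * (hRstar g f eps lamL lamR sL sR d - hR).
Proof.
by have := star_height_consistent; rewrite /flux !heightE; lra.
Qed.

End Pair.

(** The factor [2 * r] accounts for the halved cell width. Using [height_fluxR] on the left and
    [height_fluxL] on the right cancels the discharge of [s0]. The spacings are independent, as
    intermediate heights are positive for any spacing. *)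
Lemma half_cell_gt0 (sL s0 sR : astate) (dL dR r : R) :
  Omegat sL -> Omegat s0 -> Omegat sR -> 0 < r ->
  r * `|lamR sL s0| <= 4^-1 -> r * `|lamL s0 sR| <= 4^-1 ->
  0 < height (wpart s0)
      - 2 * r * (height (flux g f eps lamL lamR qt s0 sR dR)
                 - height (flux g f eps lamL lamR qt sL s0 dL)).
Proof.
move=> OL O0 OR r0.
have [_ lR0 _ _] := speedsP OL O0; have [lL0 _ _ _] := speedsP O0 OR.
rewrite (gtr0_norm lR0) (ltr0_norm lL0) => cflR cflL.
rewrite (height_fluxL _ O0 OR) (height_fluxR _ OL O0).
have [hl _] := star_height_gt0 dR O0 OR; have [_ hr] := star_height_gt0 dL OL O0.
have := mulr_gt0 (mulr_gt0 r0 lR0) hr.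
have : 0 < - (r * lamL s0 sR * hLstar g f eps lamL lamR s0 sR dR).
  by rewrite -mulNr pmulr_lgt0 // -mulrN mulr_gt0 // oppr_gt0.
(* The bound 1/4 enters here: each of the two waves removes at most half of the old height. *)
have : 0 <= height (wpart s0) * (1 - 2 * (r * lamR sL s0) + 2 * (r * lamL s0 sR)).
  by apply: mulr_ge0; [exact: ltW | lra].
by lra.
Qed.

(** * Exactness of the solver on a steady pair *)

Section SteadyPair.
Variables (sL sR : astate) (d : R).
Hypotheses (OL : Omegat sL) (OR : Omegat sR) (d_ge0 : 0 <= d).
Hypothesis (steady : local_steady_state g f sL sR d).

Local Notation hL := (height (wpart sL)).
Local Notation hR := (height (wpart sR)).
Local Notation uL := (uvel (wpart sL)).
Local Notation uR := (uvel (wpart sR)).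
Local Notation vL := (vvel (wpart sL)).
Local Notation vR := (vvel (wpart sR)).
Local Notation lL := (lamL sL sR).
Local Notation lR := (lamR sL sR).
Local Notation q := (hu (wpart sL)).
Local Notation hh := (height (hll g lamL lamR sL sR)).

Lemma steady_uvel : uL = q / hL /\ uR = q / hR.
Proof. by have [qE _ _] := local_steady_stateP steady; rewrite /uvel qE. Qed.

Lemma steady_qt : qt sL sR d = q.
Proof.
have [+ _] := qtP OL OR d_ge0; move=> /(_ steady) [-> _].
by rewrite /uvel mulrC divfK // gt_eqF.
Qed.

Lemma steady_Shv : Shv f qt sL sR d = q * (vR - vL).
Proof.
by have [_ _ ->] := local_steady_stateP steady; rewrite /Shv steady_qt.
Qed.

Lemma steady_Shu : Shu g f sL sR d = hu (Phi g (wpart sR)) - hu (Phi g (wpart sL)).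
Proof.
have [_ bE _] := local_steady_stateP steady; have [uLE uRE] := steady_uvel.
have hL0 : 0 < hL := OL.
have hR0 : 0 < hR := OR.
have hbar0 : 0 < hbar sL sR by rewrite /hbar /avg; lra.
pose X := d * f * vbar sL sR / g - zjump sL sR.
have gX : g * X = d * f * vbar sL sR - g * zjump sL sR.
  by rewrite /X mulrBr mulrC divfK // gt_eqF.
have [] := @steady_momentum R g hL hR q X g_gt0 hL0 hR0.
  by rewrite gX -bE /bernoulli -uLE -uRE /zjump /jump; ring.
(* The product is the squared discharge over [hL * hR], so the absolute value in [Fr] drops out. *)
have uu : `|uL * uR| = q / hL * (q / hR).
  rewrite uLE uRE ger0_norm //.
  rewrite mulrACA -expr2 mulr_ge0 ?sqr_ge0 //.
  by rewrite mulr_ge0 // invr_ge0 ltW.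
rewrite /= -uu -/(hbar sL sR) -/(Fr g sL sR) -uLE -uRE => XE mE.
rewrite /Phi !hu_row3 -mE /Shu steady eqxx orbF addr0 -/X /hjump /jump.
have -> : d * f * hbar sL sR * vbar sL sR - g * hbar sL sR * zjump sL sR
          = g * hbar sL sR * X.
  by rewrite [RHS]mulrAC gX; ring.
(* At [Fr = 1] the Bernoulli relation forces [X = 0] and only the cubic term remains; otherwise
   [X ^+ 2] over [(1 - Fr) ^+ 2] is the squared height jump. *)
case: eqP => /= [F1|/eqP F1].
  by rewrite XE F1; ring.
by rewrite XE; field; rewrite (gt_eqF hbar0) subr_eq0 eq_sym F1.
Qed.

Lemma steady_source :
  source g f qt sL sR d = Phi g (wpart sR) - Phi g (wpart sL).
Proof.
have [qE _ _] := local_steady_stateP steady.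
have hL0 : hL != 0 by rewrite gt_eqF.
have hR0 : hR != 0 by rewrite gt_eqF.
apply: state_eq.
- by rewrite !heightE qE subrr.
- by rewrite hu_row3 steady_Shu huD huN.
- rewrite !hvE steady_Shv; have [-> ->] := steady_uvel.
  by field; rewrite hL0 hR0.
Qed.

(** Equal discharges make [hh] a speed-weighted mean of the two heights, so the unclamped values are
    the data. The upper bound on one side is inactive because [delta] is at most the height on the
    other side. *)
Lemma steady_hstar :
  hLstar g f eps lamL lamR sL sR d = hL /\ hRstar g f eps lamL lamR sL sR d = hR.
Proof.
have [lL0 lR0 _ _] := speedsP OL OR.
have [qE _ _] := local_steady_stateP steady.
have [dL dR dh] := delta_le sL sR.
have := hll_heightE OL OR; rewrite qE subrr subr0 => hE.
have DE : Deltah g f sL sR d = hR - hL by rewrite /Deltah steady eqxx.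
rewrite /hLstar /hRstar DE.
have -> : hh - lR / (lR - lL) * (hR - hL) = hL.
  have -> : hh = (lR * hR - lL * hL) / (lR - lL) by rewrite -hE; field; lra.
  by field; lra.
have -> : hh - lL / (lR - lL) * (hR - hL) = hR.
  have -> : hh = (lR * hR - lL * hL) / (lR - lL) by rewrite -hE; field; lra.
  by field; lra.
rewrite (max_l dL) (max_l dR); split; apply: min_l.
- rewrite -(ler_nM2l lL0).
  have -> : lL * ((1 - lR / lL) * hh + lR / lL * delta g eps lamL lamR sL sR)
     = lR * delta g eps lamL lamR sL sR - (lR - lL) * hh by field; lra.
  by rewrite hE; have := ler_wpM2l (ltW lR0) dR; lra.
- rewrite -(ler_pM2l lR0).
  have -> : lR * ((1 - lL / lR) * hh + lL / lR * delta g eps lamL lamR sL sR)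
     = lL * delta g eps lamL lamR sL sR + (lR - lL) * hh by field; lra.
  by rewrite hE; have := ler_wnM2l (ltW lL0) dL; lra.
Qed.

(** The source adds back the momentum flux jump that the HLL average subtracts. *)
Lemma steady_hustar : hustar g f lamL lamR sL sR d = q.
Proof.
have [lL0 lR0 _ _] := speedsP OL OR.
have [qE _ _] := local_steady_stateP steady.
by rewrite /hustar steady_Shu /hll !huD !huN !huZ !huD !huN !huZ qE; field; lra.
Qed.

(** The source cancels the transverse flux jump [q * (vR - vL)]. On the left, removing
    [lR * hR * (vR - vL)] leaves [(lR * hR - lL * hL) * vL], that is [(lR - lL) * hh * vL]; the
    right side is symmetric. *)
Lemma steady_vstar :
  vLstar g f eps lamL lamR qt sL sR d = vL
  /\ vRstar g f eps lamL lamR qt sL sR d = vR.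
Proof.
have [lL0 lR0 _ _] := speedsP OL OR.
have [qE _ _] := local_steady_stateP steady.
have hL0 : hL != 0 by rewrite gt_eqF.
have hR0 : hR != 0 by rewrite gt_eqF.
have hh0 : hh != 0 by rewrite gt_eqF // hll_height_gt0.
have DE : Deltav g f qt sL sR d = vR - vL by rewrite /Deltav steady eqxx.
have vLE : hv (wpart sL) = hL * vL by rewrite /vvel; field.
have vRE : hv (wpart sR) = hR * vR by rewrite /vvel; field.
have hvE : (lR - lL) * hv (hll g lamL lamR sL sR)
    = lR * (hR * vR) - lL * (hL * vL) - q * (vR - vL).
  rewrite /hll !hvE; have [-> ->] := steady_uvel.
  by rewrite vLE vRE; field; rewrite hL0 hR0 /=; lra.
have := hll_heightE OL OR; rewrite qE subrr subr0 => hE.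
have D0 : lR - lL != 0 by lra.
have Dh0 : (lR - lL) * hh != 0 by rewrite mulf_neq0.
rewrite /vLstar /vRstar DE steady_Shv; have [-> ->] := steady_hstar.
have -> : hv (hll g lamL lamR sL sR) / hh
    = (lR - lL) * hv (hll g lamL lamR sL sR) / ((lR - lL) * hh).
  by field; rewrite hh0.
by rewrite hvE; split; apply: (mulIf Dh0); rewrite mulrDl !divfK // hE; ring.
Qed.

Lemma steady_flux :
  flux g f eps lamL lamR qt sL sR d
    = 2^-1 *: (Phi g (wpart sL) + Phi g (wpart sR)).
Proof.
have [qE _ _] := local_steady_stateP steady.
rewrite /flux /wLstar /wRstar steady_hustar.
have [-> ->] := steady_hstar; have [-> ->] := steady_vstar.
have -> : hL * vL = hv (wpart sL) by rewrite /vvel mulrC divfK // gt_eqF.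
have -> : hR * vR = hv (wpart sR) by rewrite /vvel mulrC divfK // gt_eqF.
by rewrite -{1}qE !row3_eta !subrr !scaler0 !addr0.
Qed.

End SteadyPair.

(** Serves the centred source: with a vanishing detector both reconstructed states of a cell
    coincide and [dx2] is zero. *)
Lemma source_same_state (s0 : astate) : Omegat s0 -> source g f qt s0 s0 0 = 0.
Proof.
move=> O0; rewrite /source /Shu /Shv /hjump /zjump /jump !subrr !mul0r !mulr0.
rewrite !mul0r subrr addr0 oppr0 expr0n /= mulr0 if_same.
by apply: state_eq; rewrite ?height_row3 ?hu_row3 ?hv_row3 /height /hu /hv mxE.
Qed.

End Solver.

(** * Admissibility of the reconstructed states *)

Section Reconstruction.
Variables (R : realType) (g f dx : R) (s sigma : int -> 'rV[R]_(3 + 1)).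
Hypotheses (dx_gt0 : 0 < dx) (sP : forall i, Omegat (s i)).
Hypothesis (sigmaP : limited_minmod_slopes dx s sigma).

Lemma theta_bound (x : R) : 0 <= theta dx x <= 1.
Proof.
have dx2 : 0 < dx ^+ 2 by rewrite exprn_gt0.
have x2 := sqr_ge0 x.
have D0 : 0 < x ^+ 2 + dx ^+ 2 by lra.
by rewrite /theta divr_ge0 ?(ltW D0) //= ler_pdivrMr // mul1r; lra.
Qed.

(** The detector turns each reconstructed height into a convex combination of the cell height and
    the fully reconstructed one, both positive. *)
Lemma rec_Omegat i :
  Omegat (rec_plus g f dx s sigma i) /\ Omegat (rec_minus g f dx s sigma i).
Proof.
have [_ _ /(_ sP) [hm hp]] := sigmaP i.
have h0 : 0 < height (wpart (s i)) := sP i.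
rewrite /Omegat /Omega /rec_plus /rec_minus !wpartD wpartN wpartZ.
rewrite !heightE /thetac.
have /andP[] := theta_bound (cell_error g f dx s i).
move: (theta dx _) (height (wpart (s i))) h0 hm hp => t h h0.
move: (height _) => a hm hp t0 t1.
have := ler_wpM2l t0 (ltW hp); have := ler_wpM2l t0 (ltW hm).
have [t_lt1|t_ge1] := ltP t 1.
  have : 0 < (1 - t) * h by apply: mulr_gt0 => //; lra.
  by split; lra.
have -> : t = 1 by lra.
by rewrite !mul1r; split; lra.
Qed.

Lemma thetac_steady : discrete_steady_state g f dx s -> forall i, thetac g f dx s i = 0.
Proof.
move=> steady i; rewrite /thetac /cell_error steady -{2}(subrK 1 i) steady.
by rewrite addr0 /theta expr0n mul0r.
Qed.

End Reconstruction.

(** * Well-balancedness and positivity of the update *)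

Theorem theorem4p2 (R : realType) (g f eps : R)
  (lamL lamR : 'rV[R]_(3 + 1) -> 'rV[R]_(3 + 1) -> R)
  (qt : 'rV[R]_(3 + 1) -> 'rV[R]_(3 + 1) -> R -> R)
  (dx dt : R) (s sigma : int -> 'rV[R]_(3 + 1))
  (g_gt0 : 0 < g) (eps_gt0 : 0 < eps)
  (speedsP : admissible_speeds lamL lamR)
  (qtP : admissible_discharge g f qt)
  (dx_gt0 : 0 < dx) (dt_gt0 : 0 < dt)
  (sP : forall i : int, Omegat (s i))
  (sigmaP : limited_minmod_slopes dx s sigma)
  (cflP : CFL g f lamL lamR dx dt s sigma) :
  (discrete_steady_state g f dx s ->
     forall i : int,
       update g f eps lamL lamR qt dx dt s sigma i = wpart (s i))
  /\ ((forall i : int, 0 < height (wpart (s i))) ->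
      forall i : int,
        0 < height (update g f eps lamL lamR qt dx dt s sigma i)).
Proof.
have [recP recM] : (forall i, Omegat (rec_plus g f dx s sigma i))
    /\ (forall i, Omegat (rec_minus g f dx s sigma i)).
  by split=> i; have [] := rec_Omegat g f dx_gt0 sP sigmaP i.
split=> [steady i | _ i].
- have recP0 j : rec_plus g f dx s sigma j = s j.
    by rewrite /rec_plus thetac_steady // mul0r scale0r addr0.
  have recM0 j : rec_minus g f dx s sigma j = s j.
    by rewrite /rec_minus thetac_steady // mul0r scale0r subr0.
  have steadyR : local_steady_state g f (s i) (s (i + 1)) dx by exact: steady.
  have steadyL : local_steady_state g f (s (i - 1)) (s i) dx.
    by have := steady (i - 1); rewrite subrK.
  have dx_ge0 := ltW dx_gt0.
  rewrite /update !recP0 !recM0 /dx1 /dx2 thetac_steady // !mul0r subr0 mulr1.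
  rewrite (source_same_state g f qt (sP i)) scaler0 addr0.
  rewrite !(steady_flux eps g_gt0 speedsP qtP) // !(steady_source g_gt0 qtP) //.
  (* The flux difference and half the sum of the two interface sources both equal half the jump of
     [Phi] from cell [i - 1] to cell [i + 1]. *)
  apply/rowP=> j; rewrite !mxE; field; lra.
- have r0 : 0 < dt / dx by rewrite divr_gt0.
  pose sP_ := rec_plus g f dx s sigma; pose sM_ := rec_minus g f dx s sigma.
  have cfl j : [/\ dt / dx * `|lamL (sM_ j) (sP_ j)| <= 4^-1,
                   dt / dx * `|lamR (sM_ j) (sP_ j)| <= 4^-1,
                   dt / dx * `|lamL (sP_ j) (sM_ (j + 1))| <= 4^-1
                 & dt / dx * `|lamR (sP_ j) (sM_ (j + 1))| <= 4^-1].
    split; apply: le_trans (cflP j);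
      by rewrite ler_pM2l // /speed_bound !le_max lexx ?orbT.
  (* The left interface of cell [i] is covered by the CFL bound at index [i - 1]. *)
  have [cML cMR cRL _] := cfl i; have [_ _ _] := cfl (i - 1); rewrite subrK => cLR.
  (* Cell [i] is split at its centre, the middle flux (spacing [0]) cancelling. *)
  have lo := half_cell_gt0 g f qt eps_gt0 speedsP (dx1 g f dx s i) 0
               (recP (i - 1)) (recM i) (recP i) r0 cLR cML.
  have hi := half_cell_gt0 g f qt eps_gt0 speedsP 0 (dx1 g f dx s i)
               (recM i) (recP i) (recM (i + 1)) r0 cMR cRL.
  have hE : height (wpart (sM_ i)) + height (wpart (sP_ i))
            = 2 * height (wpart (s i)).
    by rewrite /sM_ /sP_ /rec_minus /rec_plus !wpartD wpartN !heightD heightN; ring.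
  (* Sources have no height component, so [lo] and [hi] add up to twice the updated height. *)
  move: lo hi hE; rewrite /update /source; do 3!move: (flux _ _ _ _ _ _ _ _ _) => ?.
  by rewrite !heightE; lra.
Qed.
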